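(* Let $A,\mathcal{P}\in\mathbb{R}^{n_u\times n_u}$ be symmetric positive definite, let $\mathcal{H},\mathcal{Y}_0\in\mathbb{R}^{n_u\times 3}$, let $\mathcal{Y}^*\in\mathbb{R}^{n_u\times 3}$ be the exact solution of $A\mathcal{P}^{-1}\mathcal{Y}^*=\mathcal{H}$, let $R_0=\mathcal{H}-A\mathcal{P}^{-1}\mathcal{Y}_0$, and let $k\ge 1$. Let $\mathcal{Y}_k\in\mathbb{R}^{n_u\times 3}$ be the $k$-th iterate of the preconditioned global conjugate gradient method ($\mathcal{P}$GCG), with error $\mathcal{E}_k=\mathcal{Y}^*-\mathcal{Y}_k$, and let $$K_k=\left[R_0,(A\mathcal{P}^{-1})R_0,\dots,(A\mathcal{P}^{-1})^{k-1}R_0\right],\qquad K_{k+1}=\left[R_0,(A\mathcal{P}^{-1})R_0,\dots,(A\mathcal{P}^{-1})^{k}R_0\right].$$ If the matrices $K_k^T\diamond \mathcal{P}^{-1}A\mathcal{P}^{-1}K_k\in\mathbb{R}^{k\times k}$ and $K_{k+1}^T\diamond A^{-1}K_{k+1}\in\mathbb{R}^{(k+1)\times(k+1)}$ are nonsingular, then $$\|\mathcal{E}_k\|_{\mathcal{P}^{-1}A\mathcal{P}^{-1}}^2=\frac{1}{e_1^T\left(K_{k+1}^T\diamond A^{-1}K_{k+1}\right)^{-1}e_1},$$ where $e_1$ is the first unit vector of $\mathbb{R}^{k+1}$.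
   Context: Frobenius inner product: $\langle \mathcal{X},\mathcal{Z}\rangle_F=\mathrm{Trace}(\mathcal{X}^T\mathcal{Z})$ for $\mathcal{X},\mathcal{Z}\in\mathbb{R}^{n_u\times 3}$. For a symmetric positive definite $M\in\mathbb{R}^{n_u\times n_u}$, $\langle\mathcal{X},\mathcal{Z}\rangle_M=\mathrm{Trace}(\mathcal{Z}^TM\mathcal{X})$ and $\|\mathcal{X}\|_M=\sqrt{\mathrm{Trace}(\mathcal{X}^TM\mathcal{X})}$; this is used with $M=\mathcal{P}^{-1}$ and $M=\mathcal{P}^{-1}A\mathcal{P}^{-1}$. Diamond product: if $Y=[Y_1,\dots,Y_s]\in\mathbb{R}^{n_u\times 3s}$ and $Z=[Z_1,\dots,Z_r]\in\mathbb{R}^{n_u\times 3r}$ are concatenations of blocks $Y_i,Z_j\in\mathbb{R}^{n_u\times 3}$, then $Y^T\diamond Z\in\mathbb{R}^{s\times r}$ is the matrix with $(i,j)$ entry $\langle Y_i,Z_j\rangle_F$. For a matrix $M\in\mathbb{R}^{n_u\times n_u}$, $Y^T\diamond MZ$ means $Y^T\diamond(MZ)$, where $MZ=[MZ_1,\dots,MZ_r]$. Global Krylov subspace: $\mathcal{K}_k(A\mathcal{P}^{-1},R_0)=\left\{\sum_{i=1}^k\psi_i(A\mathcal{P}^{-1})^{i-1}R_0:\psi_1,\dots,\psi_k\in\mathbb{R}\right\}\subset\mathbb{R}^{n_u\times 3}$. $\mathcal{P}$GCG iterate: $\mathcal{Y}_k$ is characterized by the two relations $$\mathcal{Y}_k-\mathcal{Y}_0\in\mathcal{K}_k(A\mathcal{P}^{-1},R_0),\qquad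 \langle R_k,\mathcal{Z}\rangle_{\mathcal{P}^{-1}}=0\ \text{ for all }\mathcal{Z}\in\mathcal{K}_k(A\mathcal{P}^{-1},R_0),$$ where $R_k=\mathcal{H}-A\mathcal{P}^{-1}\mathcal{Y}_k=A\mathcal{P}^{-1}\mathcal{E}_k$ is the residual. The method solves the multiple right-hand side system $A\mathcal{X}=\mathcal{H}$ with preconditioner $\mathcal{P}=GG^T$, where $G$ is a nonsingular lower triangular matrix. *)

(* Defs.v *)
From mathcomp Require Import all_boot all_order all_algebra.
From mathcomp Require Import reals.

Set Implicit Arguments.
Unset Strict Implicit.
Unset Printing Implicit Defensive.

Import Order.TTheory GRing.Theory Num.Theory.
Local Open Scope ring_scope.

Definition spdmx (R : realType) (n : nat) (M : 'M[R]_n) : Prop :=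
  M^T = M /\ forall x : 'cV[R]_n, x != 0 -> 0 < (x^T *m M *m x) 0 0.

Definition frob_inner (R : realType) (n p : nat) (X Z : 'M[R]_(n, p)) : R :=
  \tr (X^T *m Z).

Definition weighted_inner (R : realType) (n p : nat) (M : 'M[R]_n)
    (X Z : 'M[R]_(n, p)) : R :=
  \tr (Z^T *m M *m X).

Definition weighted_norm (R : realType) (n p : nat) (M : 'M[R]_n)
    (X : 'M[R]_(n, p)) : R :=
  Num.sqrt (\tr (X^T *m M *m X)).

(* [diamond Y Z] is the product written Y^T <> Z: its first argument is the
   untransposed Y = [Y_1, ..., Y_s].  The width 3s is written \sum_(i < s) 3 so
   that the blocks are given by [submxrow]; left multiplication by a square
   matrix acts blockwise (mul_mxrow). *)
Definition diamond (R : realType) (n s r : nat)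
    (Y : 'M[R]_(n, \sum_(i < s) 3)) (Z : 'M[R]_(n, \sum_(j < r) 3)) :
    'M[R]_(s, r) :=
  \matrix_(i < s, j < r) frob_inner (submxrow Y i) (submxrow Z j).

Definition krylov_mx (R : realType) (n : nat) (B : 'M[R]_n) (R0 : 'M[R]_(n, 3))
    (k : nat) : 'M[R]_(n, \sum_(i < k) 3) :=
  \mxrow_(i < k) (B ^+ i *m R0).

Definition in_global_krylov (R : realType) (n : nat) (B : 'M[R]_n)
    (R0 : 'M[R]_(n, 3)) (k : nat) (Z : 'M[R]_(n, 3)) : Prop :=
  exists psi : 'I_k -> R, Z = \sum_(i < k) psi i *: (B ^+ i *m R0).

Definition residual (R : realType) (n : nat) (A P : 'M[R]_n)
    (H Y : 'M[R]_(n, 3)) : 'M[R]_(n, 3) :=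
  H - A *m invmx P *m Y.

Definition is_PGCG_iterate (R : realType) (n : nat) (A P : 'M[R]_n)
    (H Y0 : 'M[R]_(n, 3)) (k : nat) (Yk : 'M[R]_(n, 3)) : Prop :=
  let R0 := residual A P H Y0 in
  in_global_krylov (A *m invmx P) R0 k (Yk - Y0) /\
  forall Z : 'M[R]_(n, 3), in_global_krylov (A *m invmx P) R0 k Z ->
    weighted_inner (invmx P) (residual A P H Yk) Z = 0.

(* Main.v *)
Require Import Defs.
From mathcomp Require Import all_boot all_order all_algebra.
From mathcomp Require Import reals.

Import Order.TTheory GRing.Theory Num.Theory.
Local Open Scope ring_scope.

(* The residual [R_k] is a combination of the blocks of [K_(k+1)] whose
   coefficient vector [c] has first entry 1.  If [G] denotes the Gram matrix
   [K_(k+1)^T <> A^-1 K_(k+1)], then [(G c)_i = <B^i R0, A^-1 R_k>_F] with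
   [B = A P^-1], and for [i >= 1] this equals [<R_k, B^(i-1) R0>_(P^-1) = 0].
   Hence [G c = a e1] for some scalar [a]; then [c^T G c = a] is the squared
   error norm, and the first entry of [c = a G^-1 e1] reads [1 = a (G^-1)_11]. *)

(** A nonzero row [v] with [v *m M = 0] would make the quadratic form vanish at [v^T]. *)
Lemma spdmx_unit {R : realType} {n : nat} {M : 'M[R]_n} :
  spdmx M -> M \in unitmx.
Proof.
move=> [_ Mpos]; rewrite unitmxE unitfE; apply/negP => /det0P[v v0 vM0].
have := Mpos v^T; rewrite trmx_eq0 => /(_ v0).
by rewrite trmxK vM0 mul0mx mxE ltxx.
Qed.

Lemma spdmx_inv_sym {R : realType} {n : nat} {M : 'M[R]_n} :
  spdmx M -> (invmx M)^T = invmx M.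
Proof. by move=> [MT _]; rewrite trmx_inv MT. Qed.

(** Each diagonal entry of [X^T *m M *m X] is the quadratic form of [M] at a column of [X]. *)
Lemma spdmx_trace_ge0 {R : realType} {n p : nat} (M : 'M[R]_n)
    (X : 'M[R]_(n, p)) :
  spdmx M -> 0 <= \tr (X^T *m M *m X).
Proof.
move=> [_ Mpos]; apply: sumr_ge0 => j _.
have -> : (X^T *m M *m X) j j = ((col j X)^T *m M *m col j X) 0 0.
  rewrite !mxE; apply: eq_bigr => i _; rewrite !mxE; congr (_ * _).
  by apply: eq_bigr => l _; rewrite !mxE.
have [->|xn0] := eqVneq (col j X) 0; first by rewrite mulmx0 mxE.
exact: ltW (Mpos _ xn0).
Qed.

Lemma frob_inner_suml {R : realType} {n p : nat} (I : finType) (c : I -> R)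
    (X : I -> 'M[R]_(n, p)) (Z : 'M[R]_(n, p)) :
  frob_inner (\sum_i c i *: X i) Z = \sum_i c i * frob_inner (X i) Z.
Proof.
rewrite /frob_inner raddf_sum mulmx_suml raddf_sum.
by apply: eq_bigr => i _; rewrite /= linearZ -scalemxAl /= mxtraceZ.
Qed.

Lemma frob_inner_sumr {R : realType} {n p : nat} (I : finType) (c : I -> R)
    (X : I -> 'M[R]_(n, p)) (Z : 'M[R]_(n, p)) :
  frob_inner Z (\sum_i c i *: X i) = \sum_i c i * frob_inner Z (X i).
Proof.
rewrite /frob_inner mulmx_sumr raddf_sum.
by apply: eq_bigr => i _; rewrite -scalemxAr /= mxtraceZ.
Qed.

Lemma diamond_krylov_mulmx {R : realType} {n k : nat} (B M : 'M[R]_n)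
    (R0 : 'M[R]_(n, 3)) (c : 'cV[R]_k) (i : 'I_k) :
  (diamond (krylov_mx B R0 k) (M *m krylov_mx B R0 k) *m c) i 0 =
  frob_inner (B ^+ i *m R0) (M *m \sum_(j < k) c j 0 *: (B ^+ j *m R0)).
Proof.
rewrite mulmx_sumr mxE.
under [in RHS]eq_bigr do rewrite -scalemxAr.
rewrite frob_inner_sumr; apply: eq_bigr => j _.
by rewrite mxE /krylov_mx mul_mxrow !mxrowK mulrC.
Qed.

Lemma residual_krylov_coef {R : realType} {n k : nat} {A P : 'M[R]_n}
    {H Y0 Yk : 'M[R]_(n, 3)} :
  let B := A *m invmx P in
  let R0 := residual A P H Y0 in
  in_global_krylov B R0 k (Yk - Y0) ->
  exists2 c : 'cV[R]_k.+1, c 0 0 = 1 &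
    residual A P H Yk = \sum_(j < k.+1) c j 0 *: (B ^+ j *m R0).
Proof.
move=> B R0 [psi YE].
(* Since [R_k = R0 - B (Yk - Y0)], the factor [B] shifts every Krylov power up by one: [R0] keeps
   coefficient 1 and [B ^+ i.+1 *m R0] receives [- psi i]. *)
exists (\col_j if unlift ord0 j is Some i then - psi i else 1).
  by rewrite mxE unlift_none.
rewrite big_ord_recl mxE unlift_none scale1r expr0 mul1mx.
have -> : residual A P H Yk = R0 - B *m (Yk - Y0).
  by rewrite /R0 /residual -/B mulmxBr opprB addrA subrK.
rewrite YE mulmx_sumr -sumrN; congr (_ + _); apply: eq_bigr => i _.
by rewrite mxE liftK /= /bump add1n exprS -mulmxE scaleNr -scalemxAr mulmxA.
Qed.

Theorem theorem3p2 (R : realType) (n k : nat) (A P : 'M[R]_n)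
    (H Y0 Ystar Yk : 'M[R]_(n, 3)) :
  let R0 := residual A P H Y0 in
  let Kk := krylov_mx (A *m invmx P) R0 k in
  let Kk1 := krylov_mx (A *m invmx P) R0 k.+1 in
  let Ek := Ystar - Yk in
  let e1 : 'cV[R]_k.+1 := delta_mx 0 0 in
  spdmx A -> spdmx P ->
  A *m invmx P *m Ystar = H ->
  (1 <= k)%N ->
  is_PGCG_iterate A P H Y0 k Yk ->
  diamond Kk (invmx P *m A *m invmx P *m Kk) \in unitmx ->
  diamond Kk1 (invmx A *m Kk1) \in unitmx ->
  weighted_norm (invmx P *m A *m invmx P) Ek ^+ 2 =
    1 / (e1^T *m invmx (diamond Kk1 (invmx A *m Kk1)) *m e1) 0 0.
Proof.
move=> R0 Kk Kk1 Ek e1 spdA spdP HE _ [Ykry orth] _.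
set B := A *m invmx P in Ykry orth *.
set G := diamond _ _ => Gunit.
have Au := spdmx_unit spdA.
have PT := spdmx_inv_sym spdP.
have AT : A^T = A by case: spdA.
have BT : B^T = invmx P *m A by rewrite trmx_mul PT AT.
have [c c0 Rkc] := residual_krylov_coef Ykry; rewrite -/B -/R0 in Rkc.
set Rk := residual A P H Yk in Rkc orth.
have RkE : Rk = B *m Ek by rewrite /Rk /residual -/B -HE mulmxBr.
have AVRk : invmx A *m Rk = invmx P *m Ek.
  by rewrite RkE /B !mulmxA mulVmx // mul1mx.
have GcE i : (G *m c) i 0 = frob_inner (B ^+ i *m R0) (invmx A *m Rk).
  by rewrite diamond_krylov_mulmx -Rkc.
set a := (G *m c) 0 0.
have GcS (i : 'I_k) : (G *m c) (lift ord0 i) 0 = 0.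
  (* One factor [B] is moved across the trace: [B^T A^-1 = P^-1 A A^-1 = P^-1], which leaves the
     [P^-1] inner product of [Rk] with [B ^+ i *m R0]. *)
  rewrite GcE /= /bump add1n exprS -mulmxE -mulmxA /frob_inner.
  rewrite trmx_mul BT -!mulmxA [A *m _]mulmxA mulmxV // mul1mx mulmxA.
  apply: orth; exists (fun j => (j == i)%:R).
  rewrite (bigD1 i) //= eqxx scale1r big1 ?addr0 // => j /negPf ->.
  by rewrite scale0r.
have Gc : G *m c = a *: e1.
  apply/matrixP => i j; rewrite ord1 /e1 [RHS]mxE [delta_mx _ _ _ _]mxE eqxx andbT.
  case: (unliftP ord0 i) => [i' ->|->]; last by rewrite eqxx mulr1.
  by rewrite GcS mulr0.
have normE : weighted_norm (invmx P *m A *m invmx P) Ek ^+ 2 = a.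
  (* The squared norm becomes the [A]-form at [P^-1 Ek], so positivity of [A] alone allows the
     square root to be cancelled. *)
  have trE : \tr (Ek^T *m (invmx P *m A *m invmx P) *m Ek) =
             \tr ((invmx P *m Ek)^T *m A *m (invmx P *m Ek)).
    by rewrite trmx_mul PT !mulmxA.
  rewrite /weighted_norm trE sqr_sqrtr ?spdmx_trace_ge0 //.
  have -> : \tr ((invmx P *m Ek)^T *m A *m (invmx P *m Ek)) =
            frob_inner Rk (invmx A *m Rk).
    by rewrite AVRk /frob_inner RkE !trmx_mul PT AT !mulmxA.
  (* Only the left [Rk] is expanded, giving the sum of [c_i (G c)_i]; the term [i = 0] alone
     survives, with [c_0 = 1]. *)
  rewrite {1}Rkc frob_inner_suml big_ord_recl c0 mul1r -GcE big1 ?addr0 // => i _.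
  by rewrite -GcE GcS mulr0.
have cE : c = a *: (invmx G *m e1).
  by rewrite scalemxAr -Gc mulmxA mulVmx // mul1mx.
have aG : 1 = a * (e1^T *m invmx G *m e1) 0 0.
  rewrite -c0 {1}cE mxE -mulmxA; congr (_ * _).
  by rewrite /e1 trmx_delta -rowE [RHS]mxE.
(* The product being 1 forces a nonzero denominator, even without knowing beforehand that the error
   is nonzero. *)
have /andP[_ d0] : (a != 0) && ((e1^T *m invmx G *m e1) 0 0 != 0).
  by rewrite -negb_or -mulf_eq0 -aG oner_neq0.
by rewrite normE [in RHS]aG mulfK.
Qed.
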